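(* Let $0<p<2$ and $\beta\ge0$, and let $\mathbf{w}=(w_j)_{j\in\mathbb{N}}$ with $w_j:=(1+\log j)^{\beta}$. Then $$\sigma_n\big(U(\ell_p(\mathbf{w}))\big)\asymp n^{-(1/p-1/2)}[\log n]^{-\beta},\qquad n>1,$$ that is, there are constants $C_1,C_2>0$, independent of $n$ (but possibly depending on $p$ and $\beta$), such that for all integers $n>1$, $$C_1\,n^{-(1/p-1/2)}[\log n]^{-\beta}\le\sigma_n\big(U(\ell_p(\mathbf{w}))\big)\le C_2\,n^{-(1/p-1/2)}[\log n]^{-\beta}.$$
   Context: Let $\ell_2$ be the Hilbert space of real sequences $\mathbf{x}=(x_1,x_2,\ldots)$ with $\|\mathbf{x}\|_{\ell_2}^2=\sum_{j}|x_j|^2<\infty$, and let $(e_j)_{j\in\mathbb{N}}$ be its canonical basis. For $n\ge1$ let $\Sigma_n:=\{\sum_{j\in\Lambda}c_je_j:\ \Lambda\subset\mathbb{N},\ |\Lambda|=n,\ c_j\in\mathbb{R}\}$. For $\mathbf{x}\in\ell_2$ define the error of $n$-term approximation $\sigma_n(\mathbf{x}):=\inf_{S\in\Sigma_n}\|\mathbf{x}-S\|_{\ell_2}$, and for $K\subset\ell_2$ define $\sigma_n(K):=\sup_{\mathbf{x}\in K}\sigma_n(\mathbf{x})$. For $0<p<\infty$ and a nondecreasing sequence of weights $\mathbf{w}=(w_j)_{j\in\mathbb{N}}$ with $w_1\ge1$, the space $\ell_p(\mathbf{w})$ is the set of all real sequences $\mathbf{x}\in\ell_2$ with $\|\mathbf{x}\|_{\ell_p(\mathbf{w})}:=\left[\sum_{j=1}^\infty|w_jx_j|^p\right]^{1/p}<\infty$.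 Its unit ball is $U(\ell_p(\mathbf{w})):=\{\mathbf{x}\in\ell_p(\mathbf{w}):\|\mathbf{x}\|_{\ell_p(\mathbf{w})}\le1\}$. *)

(* Defs.v *)
From HB Require Import structures.
From mathcomp Require Import all_boot all_order all_algebra finmap.
From mathcomp Require Import all_classical all_reals all_analysis.

Set Implicit Arguments.
Unset Strict Implicit.
Unset Printing Implicit Defensive.

Import Order.TTheory GRing.Theory Num.Theory.
Import numFieldNormedType.Exports.

Local Open Scope classical_set_scope.
Local Open Scope ring_scope.

(* A sequence (x_1, x_2, ...) is encoded as x : nat -> R with x j standing for
   x_{j+1}. Norms, infima and suprema are taken in \bar R, where they always
   exist. *)

Definition lp_norm (R : realType) (p : R) (x : nat -> R) : \bar R :=
  'N[counting]_(p%:E)[EFin \o x]%E.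

Definition ell2 (R : realType) : set (nat -> R) :=
  [set x | (lp_norm 2 x < +oo)%E].

Definition basis_vec (R : realType) (j : nat) : nat -> R :=
  fun k => (k == j)%:R.

Definition Sigma_ (R : realType) (n : nat) : set (nat -> R) :=
  [set S | exists (L : {fset nat}) (c : nat -> R),
      #|` L|%fset = n /\ S = (fun k => \sum_(j <- L) c j * basis_vec R j k)].

Definition sigma_err (R : realType) (n : nat) (x : nat -> R) : \bar R :=
  ereal_inf [set lp_norm 2 (fun k => x k - S k) | S in Sigma_ n].

Definition sigma_class (R : realType) (n : nat) (K : set (nat -> R)) : \bar R :=
  ereal_sup [set sigma_err n x | x in K].

Definition weighted_norm (R : realType) (p : R) (w x : nat -> R) : \bar R :=
  lp_norm p (fun j => w j * x j).

Definition ell_weighted (R : realType) (p : R) (w : nat -> R) :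
    set (nat -> R) :=
  [set x | ell2 x /\ (weighted_norm p w x < +oo)%E].

Definition unit_ball (R : realType) (p : R) (w : nat -> R) : set (nat -> R) :=
  [set x | ell_weighted p w x /\ (weighted_norm p w x <= 1)%E].

(* j.+1 because of the shift of indices: the first weight is (1 + ln 1)^beta. *)
Definition log_weight (R : realType) (beta : R) : nat -> R :=
  fun j => (1 + ln (j.+1%:R : R)) `^ beta.

(* Main.v *)
Require Import Defs.
From HB Require Import structures.
From mathcomp Require Import all_boot all_order all_algebra finmap.
From mathcomp Require Import all_classical all_reals all_analysis.
From mathcomp Require Import ring zify.

Set Implicit Arguments.
Unset Strict Implicit.
Unset Printing Implicit Defensive.

Import Order.TTheory GRing.Theory Num.Theory.
Import numFieldNormedType.Exports.

Local Open Scope classical_set_scope.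
Local Open Scope ring_scope.

(** Let s = 1/p - 1/2 and w_j = (1 + log j)^beta. Both bounds hold for any
positive nondecreasing weight; the logarithms enter only at the very end.

Upper bound ([sigma_err_weighted_le]). Split the budget n = k + m into two
halves. The first k terms are spent on the first k coordinates: beyond them
the weight is at least W = w_k (in numbering from 0), so the tail of a vector
of the unit ball lies in the ball of radius 1 / W of the unweighted l_p. The
other m terms are spent on the large coordinates of the tail, as in Stechkin's
inequality. With the threshold t = m^(-1/p) / W, at most m coordinates of the
tail exceed t, since each contributes more than (W t)^p = 1/m to a sum that is
at most 1; the remaining ones satisfy |x_j|^2 <= t^(2-p) |x_j|^p, hence their
squares add up to at most t^(2-p) W^(-p) = (m^(-s) / W)^2. A threshold, unlike
the decreasing rearrangement, requires no sorting of x.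

Lower bound ([sigma_class_weighted_ge]). The vector with N = n + m equal entries
N^(-1/p) / w_{N-1} lies in the unit ball, and n terms leave at least m of these
entries untouched.

With m about n/2 above and m = n below, both bounds are n^(-s) times a power of
a logarithm comparable with log n as soon as n > 1. *)

(** * Norms of sequences as series *)

Lemma lee_poweR2r (R : realType) (p : R) (a b : \bar R) :
  0 < p -> (0 <= a)%E -> (0 <= b)%E -> (a `^ p <= b `^ p)%E = (a <= b)%E.
Proof.
move=> p0.
have mono r (x y : \bar R) :
    0 < r -> (0 <= x)%E -> (0 <= y)%E -> (x <= y -> x `^ r <= y `^ r)%E.
  move=> r0 x0 y0; apply: gt0_ler_poweR; first exact: ltW.
  - by rewrite in_itv/= x0 leey.
  - by rewrite in_itv/= y0 leey.
move=> a0 b0; apply/idP/idP; last exact: mono.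
have pV : 0 < p^-1 by rewrite invr_gt0.
move/(mono _ _ _ pV (poweR_ge0 _ _) (poweR_ge0 _ _)).
by rewrite -!poweRrM mulfV ?gt_eqF// !poweRe1.
Qed.

Lemma lp_normX (R : realType) (p : R) (x : nat -> R) : 0 < p ->
  (lp_norm p x `^ p = \sum_(k <oo) (`|x k| `^ p)%:E)%E.
Proof.
move=> p0; rewrite /lp_norm Lnorm_counting// -poweRrM mulVf ?gt_eqF//.
by rewrite poweRe1//; apply: nneseries_ge0 => k _ _; exact: poweR_ge0.
Qed.

Lemma lp_norm_le (R : realType) (p B : R) (x : nat -> R) : 0 < p -> 0 <= B ->
  (lp_norm p x <= B%:E)%E = (\sum_(k <oo) (`|x k| `^ p)%:E <= (B `^ p)%:E)%E.
Proof.
by move=> p0 B0; rewrite -lp_normX// -poweR_EFin lee_poweR2r// Lnorm_ge0.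
Qed.

Lemma lp_norm_ge (R : realType) (p B : R) (x : nat -> R) : 0 < p -> 0 <= B ->
  (B%:E <= lp_norm p x)%E = ((B `^ p)%:E <= \sum_(k <oo) (`|x k| `^ p)%:E)%E.
Proof.
by move=> p0 B0; rewrite -lp_normX// -poweR_EFin lee_poweR2r// Lnorm_ge0.
Qed.

(** * Sums over finite sets of indices *)

Lemma fset_sum_le_nneseries (R : realType) (f : nat -> R) (F : {fset nat}) :
  (forall k, 0 <= f k) ->
  ((\sum_(k <- F) f k)%:E <= \sum_(k <oo) (f k)%:E)%E.
Proof.
move=> f0; rewrite nneseries_esumT => [|k]; last by rewrite lee_fin.
apply: esum_ge; exists [set` F]; first by split => //; exact: finite_fset.
by rewrite -sumEFin fsbig_seq.
Qed.

Lemma nneseries_finsupp (R : realType) (f : nat -> R) (N : nat) :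
  (forall k, 0 <= f k) -> (forall k, (N <= k)%N -> f k = 0) ->
  (\sum_(k <oo) (f k)%:E = (\sum_(k < N) f k)%:E)%E.
Proof.
move=> f0 fN; rewrite (nneseries_split 0 N) => [|k _]; last by rewrite lee_fin.
rewrite add0n eseries0 ?adde0; last by move=> k Nk _; rewrite fN.
by rewrite big_mkord sumEFin.
Qed.

(** * The error of n-term approximation *)

Lemma fset_enlarge (L : {fset nat}) (n : nat) : (#|` L| <= n)%N ->
  exists L' : {fset nat}, (L `<=` L')%fset /\ #|` L'| = n.
Proof.
elim: n => [|n IH]; first by exists L; split; [|apply/eqP; rewrite -leqn0].
rewrite leq_eqVlt => /predU1P[Ln|]; first by exists L.
rewrite ltnS => /IH[L' [LL' cL']].
pose k := (\max_(i <- L') i).+1.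
have kL' : k \notin L'.
  apply/negP => kL'; have : (k <= \max_(i <- L') i)%N by exact: leq_bigmax_seq.
  by rewrite ltnn.
exists (k |` L')%fset; split; first exact/(fsubset_trans LL')/fsubsetU1.
by rewrite cardfsU1 kL' cL'.
Qed.

Lemma sum_basisE (R : realType) (L : {fset nat}) (c : nat -> R) (k : nat) :
  \sum_(j <- L) c j * basis_vec R j k = if k \in L then c k else 0.
Proof.
case: ifPn => kL.
  rewrite (big_fsetD1 k)//= /basis_vec eqxx mulr1 big1_fset ?addr0// => j.
  by rewrite !inE => /andP[jk _] _; rewrite eq_sym (negPf jk) mulr0.
rewrite big1_fset// => j jL _; rewrite /basis_vec; case: eqP => [kj|].
  by rewrite kj jL in kL.
by rewrite mulr0.
Qed.

(** An index set with fewer than n elements may be padded: on the added indices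
the approximant copies x, so the error can only decrease. *)
Lemma sigma_err_le (R : realType) (n : nat) (x : nat -> R) (L : {fset nat}) :
  (#|` L| <= n)%N ->
  (sigma_err n x <= lp_norm 2%R (fun k => if k \in L then 0%R else x k))%E.
Proof.
move=> /fset_enlarge[L' [/fsubsetP LL' cL']].
apply: ge_ereal_inf; eexists.
  exists (fun k => \sum_(j <- L') x j * basis_vec R j k); last by [].
  by exists L', x.
rewrite -(lee_poweR2r (p := 2%R))// ?Lnorm_ge0// !lp_normX//.
apply: lee_nneseries => [k _ _|k _]; first by rewrite lee_fin powR_ge0.
rewrite sum_basisE lee_fin; case: ifPn => [_|kL'].
  by rewrite subrr normr0 powR0 ?powR_ge0// pnatr_eq0.
by rewrite subr0 ifN//; apply: contra kL'; exact: LL'.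
Qed.

Definition initial_segment (N : nat) : {fset nat} := seq_fset tt (iota 0 N).

Lemma in_initial_segment (N k : nat) : (k \in initial_segment N) = (k < N)%N.
Proof. by rewrite seq_fsetE mem_iota. Qed.

Lemma card_initial_segment (N : nat) : #|` initial_segment N| = N.
Proof. by rewrite size_seq_fset undup_id ?iota_uniq// size_iota. Qed.

(** The normalization behind both bounds: it makes the p-th power of a weighted
coordinate equal to 1/a, so that a such coordinates fill the unit ball. *)
Lemma powR_normalized (R : realType) (p a W : R) : 0 < p -> 0 < a -> 0 < W ->
  (W * (a `^ (- p^-1) / W)) `^ p = a^-1.
Proof.
move=> p0 a0 W0; rewrite mulrCA mulfV ?gt_eqF// mulr1 -powRrM mulNr.
by rewrite mulVf ?gt_eqF// powR_inv1// ltW.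
Qed.

(** * Bounds for nondecreasing weights *)

(** Weighted form of Stechkin's inequality: k terms of the approximation go to
the first coordinates, where the weight is small, and m terms to the large
coordinates among the others. *)
Lemma sigma_err_weighted_le (R : realType) (p : R) (w x : nat -> R)
    (k m : nat) :
  0 < p -> p < 2 -> {homo w : i j / (i <= j)%N >-> i <= j} -> 0 < w k ->
  (0 < m)%N -> (weighted_norm p w x <= 1)%E ->
  (sigma_err (k + m) x <= (m%:R `^ (- (p^-1 - 2^-1)) / w k)%:E)%E.
Proof.
move=> p0 p2 w_nd wk0 m0.
rewrite /weighted_norm lp_norm_le// powR1 => sum_le1.
have wx_ge0 j : 0 <= `|w j * x j| `^ p by exact: powR_ge0.
have mR0 : 0 < m%:R :> R by rewrite ltr0n.
set s := p^-1 - 2^-1.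
pose t := m%:R `^ (- p^-1) / w k.
have t0 : 0 < t by rewrite divr_gt0// powR_gt0.
have wk_le j : (k <= j)%N -> w k * `|x j| <= `|w j * x j|.
  move=> /w_nd kj; rewrite normrM ler_wpM2r//.
  by rewrite (le_trans kj)// ler_norm.
pose big := [set j | (k <= j)%N && (t < `|x j|)].
(* Each index of big contributes at least 1/m to a sum bounded by 1. This is
   stated for finite subsets because it is also what makes big finite. *)
have card_big (F : {fset nat}) : [set` F] `<=` big -> (#|` F| <= m)%N.
  move=> Fbig; rewrite -(ler_nat R) -[leRHS]mul1r -ler_pdivrMr//.
  rewrite -lee_fin; apply: le_trans sum_le1.
  apply: le_trans (fset_sum_le_nneseries F wx_ge0); rewrite lee_fin.
  have -> : #|` F|%:R / m%:R = \sum_(j <- F) m%:R^-1 :> R.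
    by rewrite big_const_seq count_predT iter_addr_0 mulr_natl.
  rewrite big_seq [leRHS]big_seq.
  apply: ler_sum => j /Fbig /andP[kj tj].
  rewrite -(powR_normalized p0 mR0 wk0) -/t.
  apply: ge0_ler_powR; rewrite ?nnegrE ?(ltW p0)//.
    by rewrite mulr_ge0// ltW.
  by apply: le_trans (wk_le _ kj); rewrite ler_pM2l// ltW.
have fin_big : finite_set big.
  apply: contrapT => /(infinite_set_fset m.+1)[F /card_big Fm].
  by rewrite ltnNge Fm.
pose L := (initial_segment k `|` fset_set big)%fset.
have cL : (#|` L| <= k + m)%N.
  rewrite (leq_trans (leq_card_fsetU _ _))// card_initial_segment leq_add2l.
  by apply: card_big; rewrite fset_setK.
apply: le_trans (sigma_err_le x cL) _.
rewrite lp_norm_le//; last by rewrite divr_ge0 ?powR_ge0 ?(ltW wk0).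
have -> : (m%:R `^ (- s) / w k) `^ 2 = t `^ (2 - p) * (w k)^-1 `^ p.
  have wV0 : 0 <= (w k)^-1 by rewrite invr_ge0 ltW.
  rewrite /t !powRM ?powR_ge0// -mulrA -powRD; last first.
    by rewrite subrK pnatr_eq0.
  rewrite subrK -!powRrM; congr (_ `^ _ * _).
  by rewrite /s; field; rewrite gt_eqF.
(* The bound 1 on the weighted sum is put back on the right, which reduces the
   claim to a comparison of the two series term by term. *)
rewrite -[leRHS]mule1.
apply: le_trans (lee_wpmul2l _ sum_le1); last first.
  by rewrite lee_fin mulr_ge0// powR_ge0.
rewrite -nneseriesZl => [|j _]; last by rewrite lee_fin.
apply: lee_nneseries => [j _ _|j _]; first by rewrite lee_fin powR_ge0.
rewrite -EFinM lee_fin; case: ifPn => [_|].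
  by rewrite normr0 powR0 ?mulr_ge0 ?powR_ge0// pnatr_eq0.
rewrite in_fsetU in_initial_segment in_fset_set// negb_or -leqNgt.
move=> /andP[kj]; rewrite notin_setE /= => /negP; rewrite kj/= -leNgt => xt.
(* An index outside L has |x_j| <= t, so that
   |x_j|^2 = |x_j|^(2-p) |x_j|^p <= t^(2-p) (w_j |x_j| / w_k)^p. *)
rewrite -[X in _ `^ X](subrK p) powRD; last by rewrite subrK pnatr_eq0.
rewrite -mulrA; apply: ler_pM; rewrite ?powR_ge0//.
  by apply: ge0_ler_powR; rewrite ?nnegrE ?subr_ge0 ?(ltW p2) ?(ltW t0).
rewrite -powRM ?invr_ge0 ?(ltW wk0)//.
apply: ge0_ler_powR; rewrite ?nnegrE ?(ltW p0)//.
  by rewrite mulr_ge0// invr_ge0 ltW.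
by rewrite mulrC ler_pdivlMr// mulrC wk_le.
Qed.

(** The extremal vector is constant on the first n + m coordinates: whichever
n indices are chosen, m of its entries survive. *)
Lemma sigma_class_weighted_ge (R : realType) (p : R) (w : nat -> R)
    (n m : nat) :
  0 < p -> {homo w : i j / (i <= j)%N >-> i <= j} ->
  (forall j, 0 <= w j) -> 0 < w (n + m).-1 -> (0 < n + m)%N ->
  ((m%:R `^ 2^-1 * ((n + m)%:R `^ (- p^-1) / w (n + m).-1))%:E
     <= sigma_class n (unit_ball p w))%E.
Proof.
move=> p0 w_nd w_ge0; set N := (n + m)%N => wN0 N0.
have NR0 : 0 < N%:R :> R by rewrite ltr0n.
pose c := N%:R `^ (- p^-1) / w N.-1.
have c0 : 0 <= c by rewrite divr_ge0// powR_ge0.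
pose x k : R := if (k < N)%N then c else 0.
have x_out k : (N <= k)%N -> x k = 0 by rewrite /x ltnNge => ->.
apply: le_ereal_sup_tmp; exists (sigma_err n x).
  exists x => //; rewrite /unit_ball/= /ell_weighted/=.
  suff wx1 : (weighted_norm p w x <= 1)%E.
    split; last exact: wx1.
    split; last by rewrite (le_lt_trans wx1)// ltry.
    apply: (@lty_poweRy _ _ 2%R); rewrite ?pnatr_eq0// lp_normX//.
    rewrite (nneseries_finsupp (N := N)) ?ltry// => k.
    by move=> /x_out ->; rewrite normr0 powR0// pnatr_eq0.
  rewrite /weighted_norm lp_norm_le// powR1.
  rewrite (nneseries_finsupp (N := N))//; last first.
    by move=> k /x_out ->; rewrite mulr0 normr0 powR0// gt_eqF.
  have -> : 1%E = (\sum_(k < N) N%:R^-1 : R)%:E.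
    by rewrite sumr_const card_ord -[_ *+ _]mulr_natr mulVf// gt_eqF.
  rewrite lee_fin; apply: ler_sum => k _.
  rewrite -(powR_normalized p0 NR0 wN0) -/c.
  apply: ge0_ler_powR; rewrite ?nnegrE ?(ltW p0)//.
    by rewrite mulr_ge0.
  rewrite /x ltn_ord ger0_norm ?(mulr_ge0 _ c0)// ler_wpM2r//.
  by apply: w_nd; rewrite -ltnS prednK.
apply/ereal_infP => _ [S [L [a [cL ->]]] <-].
rewrite -/c lp_norm_ge//; last by rewrite mulr_ge0// powR_ge0.
pose D := (initial_segment N `\` L)%fset.
have cD : (m <= #|` D|)%N.
  rewrite cardfsD card_initial_segment leq_subRL; last first.
    by rewrite -[leqRHS]card_initial_segment fsubset_leq_card// fsubsetIl.
  by rewrite addnC /N addnC leq_add2r -cL fsubset_leq_card// fsubsetIr.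
apply: le_trans (fset_sum_le_nneseries D _); last by move=> k; exact: powR_ge0.
rewrite lee_fin powRM ?powR_ge0// -powRrM mulVf ?pnatr_eq0// powRr1//.
rewrite big_seq (eq_bigr (fun=> c `^ 2)) => [|k]; last first.
  rewrite in_fsetD in_initial_segment => /andP[kL kN].
  by rewrite sum_basisE (negPf kL) subr0 /x kN ger0_norm.
rewrite -big_seq big_const_seq count_predT iter_addr_0.
by rewrite -[leRHS]mulr_natl ler_wpM2r ?powR_ge0// ler_nat.
Qed.

(** * Logarithmic weights *)

Lemma log_weight_nd (R : realType) (beta : R) : 0 <= beta ->
  {homo @log_weight R beta : i j / (i <= j)%N >-> i <= j}.
Proof.
move=> b0 i j ij.
have ln_ge k : 0 <= ln (k.+1%:R : R) by rewrite ln_ge0// ler1n.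
apply: ge0_ler_powR; rewrite ?nnegrE ?addr_ge0//.
by rewrite lerD2l ler_ln ?posrE ?ltr0n// ler_nat ltnS.
Qed.

Lemma log_weight_gt0 (R : realType) (beta : R) j : 0 < @log_weight R beta j.
Proof. by rewrite powR_gt0// ltr_wpDr// ln_ge0// ler1n. Qed.

Theorem corollary3p1 (R : realType) (p beta : R)
    (hp0 : 0 < p) (hp2 : p < 2) (hbeta : 0 <= beta) :
  exists C1 C2 : R, [/\ 0 < C1, 0 < C2 &
    forall n : nat, (1 < n)%N ->
      ((C1 * (n%:R `^ (- (p^-1 - 2^-1)) * ln n%:R `^ (- beta)))%:E
         <= sigma_class n (unit_ball p (log_weight beta)))%E /\
      (sigma_class n (unit_ball p (log_weight beta))
         <= (C2 * (n%:R `^ (- (p^-1 - 2^-1)) * ln n%:R `^ (- beta)))%:E)%E].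
Proof.
have ln2 : 0 < ln 2 :> R by rewrite ln_gt0// ltr1n.
(* K is chosen so that 1 + ln (2 n) = (1 + ln 2) + ln n <= K ln n for n >= 2. *)
pose K : R := 1 + (1 + ln 2) / ln 2.
have K0 : 0 < K by rewrite addr_gt0// divr_gt0// addr_gt0.
set s := p^-1 - 2^-1.
have s0 : 0 < s by rewrite subr_gt0 ltf_pV2// posrE.
exists (2 `^ (- p^-1) * K `^ (- beta)), (3 `^ s).
split; rewrite ?mulr_gt0 ?powR_gt0// => n n1.
have n0 : (0 < n)%N by exact: ltnW.
have nR0 : 0 < n%:R :> R by rewrite ltr0n.
have lnn0 : 0 < ln n%:R :> R by rewrite ln_gt0// ltr1n.
split.
  have nn0 : (0 < n + n)%N by rewrite addn_gt0 n0.
  apply: le_trans (sigma_class_weighted_ge hp0 (log_weight_nd hbeta)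
    (fun j => ltW (log_weight_gt0 beta j)) (log_weight_gt0 beta _) nn0).
  rewrite lee_fin.
  have lnK : 1 + ln (n + n)%:R <= K * ln n%:R.
    rewrite addnn -mul2n natrM lnM ?posrE// addrA /K mulrDl mul1r addrC lerD2l.
    rewrite mulrAC -mulrA ler_peMr ?addr_ge0 ?(ltW ln2)// ler_pdivlMr// mul1r.
    by rewrite ler_ln ?posrE// ler_nat.
  have -> :
      2 `^ (- p^-1) * K `^ (- beta) * (n%:R `^ (- s) * ln n%:R `^ (- beta))
      = n%:R `^ 2^-1 * ((n + n)%:R `^ (- p^-1) * (K * ln n%:R) `^ (- beta)).
    rewrite addnn -mul2n natrM !powRM ?(ltW K0) ?(ltW lnn0)//.
    have -> : - s = 2^-1 + - p^-1 by rewrite /s; ring.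
    by rewrite powRD ?(gt_eqF nR0) ?implybT//; ring.
  rewrite ler_pM2l ?powR_gt0// ler_pM2l ?powR_gt0 ?ltr0n// /log_weight prednK//.
  have ln0 : 0 < 1 + ln (n + n)%:R :> R by rewrite ltr_wpDr// ln_ge0// ler1n.
  rewrite powRN lef_pV2 ?posrE ?powR_gt0// ?mulr_gt0//.
  by apply: ge0_ler_powR => //; rewrite nnegrE ltW// mulr_gt0.
apply/ereal_supP => _ [x [_ x1] <-].
(* Here m >= n/3, with equality at n = 3; this is where 3 in C2 comes from. As
   k + 1 >= n/2 and ln 2 <= 1, the weight at k is at least (ln n)^beta, with no
   further constant. *)
pose m := n./2; pose k := uphalf n.
have km : (k + m = n)%N.
  by rewrite /k /m uphalf_half -addnA addnn odd_double_half.
have m0 : (0 < m)%N by rewrite half_gt0.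
have := sigma_err_weighted_le hp0 hp2 (log_weight_nd hbeta)
  (log_weight_gt0 beta k) m0 x1.
rewrite km => /le_trans; apply; rewrite lee_fin mulrA.
apply: ler_pM; rewrite ?powR_ge0 ?invr_ge0 ?powR_ge0//.
  have -> : 3 `^ s = (3^-1) `^ (- s).
    by rewrite -powR_inv1// -powRrM mulN1r opprK.
  rewrite -powRM ?invr_ge0// !powRN lef_pV2 ?posrE ?powR_gt0 ?mulr_gt0 ?ltr0n//.
  apply: ge0_ler_powR; rewrite ?nnegrE ?(ltW s0)// mulrC ler_pdivrMr//.
  by rewrite -natrM ler_nat /m; lia.
rewrite powRN lef_pV2 ?posrE ?powR_gt0 ?ltr_wpDr ?ln_ge0 ?ler1n//.
apply: ge0_ler_powR; rewrite ?nnegrE ?(ltW lnn0) ?addr_ge0 ?ln_ge0 ?ler1n//.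
have ln2_le1 : ln 2 <= 1 :> R by rewrite -[2]/(1 + 1) le_ln1Dx// ltrN10.
apply: le_trans (_ : ln (2 * k.+1%:R) <= _).
  by rewrite ler_ln ?posrE ?mulr_gt0 ?ltr0n// -natrM ler_nat /k; lia.
by rewrite lnM ?posrE ?ltr0n// lerD2r.
Qed.
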